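(* Let $n\ge 1$ and let $(\rho,\eta,L)$ be a Schürmann triple on $\mathrm{Pol}(S_n^+)$. Then the generating functional $L$ is uniquely determined by the representation $\rho$ and the cocycle $\eta$ (that is, if $(\rho,\eta,L')$ is also a Schürmann triple on $\mathrm{Pol}(S_n^+)$, then $L'=L$). Moreover, writing $\xi_{ij}:=\eta(p_{ij})$, on the generators one has $$L(p_{ij})=(-1)^{\delta_{ij}}\|\xi_{ij}\|^2,\qquad i,j=1,\ldots,n.$$
   Context: $\mathrm{Pol}(S_n^+)$ is the universal unital $*$-algebra generated by elements $p_{ij}$ ($1\le i,j\le n$) subject to $p_{ij}=p_{ij}^*=p_{ij}^2$, $p_{ij}p_{ik}=0=p_{ji}p_{ki}$ for $j\ne k$, and $\sum_{j=1}^n p_{ij}=\sum_{j=1}^n p_{ji}=1$ for all $i$. Its counit is the character $\varepsilon:\mathrm{Pol}(S_n^+)\to\mathbb{C}$ with $\varepsilon(p_{ij})=\delta_{ij}$. Inner products are linear in the second argument. A Schürmann triple $(\rho,\eta,L)$ on $\mathrm{Pol}(S_n^+)$ consists of a unital $*$-homomorphism $\rho:\mathrm{Pol}(S_n^+)\to B(\mathsf{h})$ for a Hilbert space $\mathsf{h}$, a linear map $\eta:\mathrm{Pol}(S_n^+)\to\mathsf{h}$ that is a $\rho$-$\varepsilon$-cocycle, i.e. $\eta(ab)=\rho(a)\eta(b)+\eta(a)\varepsilon(b)$ for all $a,b$, and a hermitian linear functional $L:\mathrm{Pol}(S_n^+)\to\mathbb{C}$ (i.e. $L(a^* )=\overline{L(a)}$)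 with $L(a^*b)=\langle\eta(a),\eta(b)\rangle+\varepsilon(a^* )L(b)+L(a^* )\varepsilon(b)$ for all $a,b$. Such an $L$ is a generating functional, i.e. $L(1)=0$, $L$ is hermitian, and $L(a^*a)\ge0$ whenever $\varepsilon(a)=0$. *)

(* Defs.v *)
From HB Require Import structures.
From mathcomp Require Import all_boot all_order all_algebra.
From mathcomp Require Import complex.
From mathcomp Require Import all_classical all_reals topology normedtype.

Set Implicit Arguments.
Unset Strict Implicit.
Unset Printing Implicit Defensive.

Import Order.TTheory GRing.Theory Num.Theory.
Import numFieldNormedType.Exports.

Local Open Scope ring_scope.
Local Open Scope quotient_scope.

HB.mixin Record Algebra_isStarAlgebra (C : numClosedFieldType) A
    of GRing.Algebra C A := {
  star : A -> A;
  starD : forall a b : A, star (a + b) = star a + star b;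
  starZ : forall (c : C) (a : A), star (c *: a) = c^* *: star a;
  starM : forall a b : A, star (a * b) = star b * star a;
  starK : forall a : A, star (star a) = a
}.

#[short(type="starAlgType")]
HB.structure Definition StarAlgebra (C : numClosedFieldType) :=
  {A of GRing.Algebra C A & Algebra_isStarAlgebra C A}.

Section Regular.
Variable C : numClosedFieldType.
Let conj_scale (c : C) (a : C^o) : (c *: a)^* = c^* *: (a^* : C^o).
Proof. exact: rmorphM. Qed.
Let conj_mul (a b : C^o) : (a * b)^* = (b^* : C^o) * a^*.
Proof. by rewrite mulrC; exact: rmorphM. Qed.
HB.instance Definition _ := Algebra_isStarAlgebra.Build C C^o
  (fun a b => rmorphD (@Num.conj C) a b) conj_scale conj_mul (@conjCK C).
End Regular.

Record magic_unitary (C : numClosedFieldType) (A : starAlgType C) (n : nat)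
    (u : 'I_n -> 'I_n -> A) : Prop := MagicUnitary {
  magic_star : forall i j, star (u i j) = u i j;
  magic_idem : forall i j, u i j * u i j = u i j;
  magic_row_orth : forall i j k : 'I_n, j != k -> u i j * u i k = 0;
  magic_col_orth : forall i j k : 'I_n, j != k -> u j i * u k i = 0;
  magic_row_sum : forall i, \sum_j u i j = 1;
  magic_col_sum : forall i, \sum_j u j i = 1
}.

(** The universal unital star-algebra generated by a magic unitary is built
    as the star-algebra expressions in the generators, modulo the congruence
    generated by the star-algebra axioms and the defining relations;
    [PolSn_universal] below is its universal property. *)

Inductive expr (C : Type) (n : nat) : Type :=
| Egen of 'I_n & 'I_n
| Ezero
| Eone
| Eadd of expr C n & expr C n
| Escale of C & expr C n
| Emul of expr C n & expr C n
| Estar of expr C n.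

Arguments Egen {C n}.
Arguments Ezero {C n}.
Arguments Eone {C n}.

Inductive expr_eq (C : numClosedFieldType) (n : nat) :
    expr C n -> expr C n -> Prop :=
| Eq_refl a : expr_eq a a
| Eq_sym a b : expr_eq a b -> expr_eq b a
| Eq_trans a b c : expr_eq a b -> expr_eq b c -> expr_eq a c
| Eq_add a a' b b' :
    expr_eq a a' -> expr_eq b b' -> expr_eq (Eadd a b) (Eadd a' b')
| Eq_scale k a a' : expr_eq a a' -> expr_eq (Escale k a) (Escale k a')
| Eq_mul a a' b b' :
    expr_eq a a' -> expr_eq b b' -> expr_eq (Emul a b) (Emul a' b')
| Eq_star a a' : expr_eq a a' -> expr_eq (Estar a) (Estar a')
| Eq_addA a b c : expr_eq (Eadd a (Eadd b c)) (Eadd (Eadd a b) c)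
| Eq_addC a b : expr_eq (Eadd a b) (Eadd b a)
| Eq_add0 a : expr_eq (Eadd Ezero a) a
| Eq_addN a : expr_eq (Eadd (Escale (-1) a) a) Ezero
| Eq_scaleA k l a : expr_eq (Escale k (Escale l a)) (Escale (k * l) a)
| Eq_scale1 a : expr_eq (Escale 1 a) a
| Eq_scaleDr k a b :
    expr_eq (Escale k (Eadd a b)) (Eadd (Escale k a) (Escale k b))
| Eq_scaleDl k l a :
    expr_eq (Escale (k + l) a) (Eadd (Escale k a) (Escale l a))
| Eq_mulA a b c : expr_eq (Emul a (Emul b c)) (Emul (Emul a b) c)
| Eq_mul1l a : expr_eq (Emul Eone a) a
| Eq_mul1r a : expr_eq (Emul a Eone) a
| Eq_mulDl a b c :
    expr_eq (Emul (Eadd a b) c) (Eadd (Emul a c) (Emul b c))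
| Eq_mulDr a b c :
    expr_eq (Emul a (Eadd b c)) (Eadd (Emul a b) (Emul a c))
| Eq_scaleAl k a b : expr_eq (Escale k (Emul a b)) (Emul (Escale k a) b)
| Eq_scaleAr k a b : expr_eq (Escale k (Emul a b)) (Emul a (Escale k b))
| Eq_starD a b : expr_eq (Estar (Eadd a b)) (Eadd (Estar a) (Estar b))
| Eq_starZ k a : expr_eq (Estar (Escale k a)) (Escale k^* (Estar a))
| Eq_starM a b : expr_eq (Estar (Emul a b)) (Emul (Estar b) (Estar a))
| Eq_starK a : expr_eq (Estar (Estar a)) a
| Eq_gen_star i j : expr_eq (Estar (Egen i j)) (Egen i j)
| Eq_gen_idem i j : expr_eq (Emul (Egen i j) (Egen i j)) (Egen i j)
| Eq_gen_row (i j k : 'I_n) : j != k ->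
    expr_eq (Emul (Egen i j) (Egen i k)) Ezero
| Eq_gen_col (i j k : 'I_n) : j != k ->
    expr_eq (Emul (Egen j i) (Egen k i)) Ezero
| Eq_gen_row_sum i :
    expr_eq (\big[@Eadd C n/Ezero]_(j < n) Egen i j) Eone
| Eq_gen_col_sum i :
    expr_eq (\big[@Eadd C n/Ezero]_(j < n) Egen j i) Eone.

Section Eval.
Variables (C : numClosedFieldType) (n : nat) (A : starAlgType C).
Variable u : 'I_n -> 'I_n -> A.

Fixpoint eval (e : expr C n) : A :=
  match e with
  | Egen i j => u i j
  | Ezero => 0
  | Eone => 1
  | Eadd a b => eval a + eval b
  | Escale k a => k *: eval a
  | Emul a b => eval a * eval b
  | Estar a => star (eval a)
  end.

Lemma eval_sum (F : 'I_n -> expr C n) :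
  eval (\big[@Eadd C n/Ezero]_(j < n) F j) = \sum_(j < n) eval (F j).
Proof. exact: (big_morph eval (fun _ _ => erefl) erefl). Qed.

Lemma eval_eq (a b : expr C n) :
  magic_unitary u -> expr_eq a b -> eval a = eval b.
Proof.
move=> [uS uI uR uC uRs uCs]; elim=> //=.
- by move=> x y z _ -> _ ->.
- by move=> x x' y y' _ -> _ ->.
- by move=> k x x' _ ->.
- by move=> x x' y y' _ -> _ ->.
- by move=> x x' _ ->.
- by move=> x y z; rewrite addrA.
- by move=> x y; rewrite addrC.
- by move=> x; rewrite add0r.
- by move=> x; rewrite scaleN1r addNr.
- by move=> k l x; rewrite scalerA.
- by move=> x; rewrite scale1r.
- by move=> k x y; rewrite scalerDr.
- by move=> k l x; rewrite scalerDl.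
- by move=> x y z; rewrite mulrA.
- by move=> x; rewrite mul1r.
- by move=> x; rewrite mulr1.
- by move=> x y z; rewrite mulrDl.
- by move=> x y z; rewrite mulrDr.
- by move=> k x y; rewrite scalerAl.
- by move=> k x y; rewrite scalerAr.
- by move=> x y; rewrite starD.
- by move=> k x; rewrite starZ.
- by move=> x y; rewrite starM.
- by move=> x; rewrite starK.
- by move=> i; rewrite eval_sum; exact: uRs.
- by move=> i; rewrite eval_sum; exact: uCs.
Qed.

End Eval.

Lemma delta_magic (C : numClosedFieldType) (n : nat) :
  magic_unitary (fun i j : 'I_n => (i == j)%:R : C^o).
Proof.
split=> [i j|i j|i j k jk|i j k jk|i|i].
- exact: conjC_nat.
- by rewrite -natrM mulnb andbb.
- rewrite -natrM mulnb; case: eqP => // ->.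
  by rewrite (negbTE jk).
- rewrite -natrM mulnb; case: eqP => // <-.
  by rewrite eq_sym (negbTE jk).
- rewrite (bigD1 i) //= eqxx big1 ?addr0 // => j.
  by rewrite eq_sym => /negbTE ->.
- by rewrite (bigD1 i) //= eqxx big1 ?addr0 // => j /negbTE ->.
Qed.

Section Quotient.
Variables (C : numClosedFieldType) (n : nat).

HB.instance Definition _ := gen_eqMixin (expr C n).
HB.instance Definition _ := gen_choiceMixin (expr C n).

Definition expr_eqb (a b : expr C n) : bool := `[< expr_eq a b >].

Let expr_eqb_refl : reflexive expr_eqb.
Proof. by move=> a; apply/asboolP; exact: Eq_refl. Qed.
Let expr_eqb_sym : symmetric expr_eqb.
Proof. by move=> a b; apply/asboolP/asboolP; exact: Eq_sym. Qed.
Let expr_eqb_trans : transitive expr_eqb.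
Proof.
move=> b a c /asboolP ab /asboolP bc; apply/asboolP; exact: Eq_trans ab bc.
Qed.

Canonical expr_eqb_equiv :=
  EquivRel expr_eqb expr_eqb_refl expr_eqb_sym expr_eqb_trans.

Definition PolSn : Type := {eq_quot expr_eqb}.

HB.instance Definition _ := Choice.on PolSn.

Definition pol (a : expr C n) : PolSn := \pi_{eq_quot expr_eqb} a.
Definition pol_repr (x : PolSn) : expr C n := repr (x : {eq_quot expr_eqb}).

Lemma polP (a b : expr C n) : (pol a = pol b) <-> expr_eq a b.
Proof.
split; first by move=> /eqmodP /asboolP.
by move=> ab; apply/eqmodP/asboolP.
Qed.

Lemma pol_reprK (x : PolSn) : pol (pol_repr x) = x.
Proof. exact: reprK. Qed.

Lemma pol_reprP (a : expr C n) : expr_eq (pol_repr (pol a)) a.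
Proof. by apply/polP; rewrite pol_reprK. Qed.

Lemma pol_ind (P : PolSn -> Prop) : (forall a, P (pol a)) -> forall x, P x.
Proof. by move=> H x; rewrite -(pol_reprK x). Qed.

Definition pol_gen (i j : 'I_n) : PolSn := pol (Egen i j).
Definition pol_add (x y : PolSn) : PolSn :=
  pol (Eadd (pol_repr x) (pol_repr y)).
Definition pol_scale (k : C) (x : PolSn) : PolSn :=
  pol (Escale k (pol_repr x)).
Definition pol_mul (x y : PolSn) : PolSn :=
  pol (Emul (pol_repr x) (pol_repr y)).
Definition pol_star (x : PolSn) : PolSn := pol (Estar (pol_repr x)).

Lemma pol_addE a b : pol_add (pol a) (pol b) = pol (Eadd a b).
Proof. by apply/polP/Eq_add; exact: pol_reprP. Qed.
Lemma pol_scaleE k a : pol_scale k (pol a) = pol (Escale k a).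
Proof. by apply/polP/Eq_scale; exact: pol_reprP. Qed.
Lemma pol_mulE a b : pol_mul (pol a) (pol b) = pol (Emul a b).
Proof. by apply/polP/Eq_mul; exact: pol_reprP. Qed.
Lemma pol_starE a : pol_star (pol a) = pol (Estar a).
Proof. by apply/polP/Eq_star; exact: pol_reprP. Qed.

Let polE := (pol_addE, pol_scaleE, pol_mulE, pol_starE).

Let pol_addA : associative pol_add.
Proof.
by elim/pol_ind=> a; elim/pol_ind=> b; elim/pol_ind=> c;
  rewrite !polE; apply/polP/Eq_addA.
Qed.
Let pol_addC : commutative pol_add.
Proof.
by elim/pol_ind=> a; elim/pol_ind=> b; rewrite !polE; apply/polP/Eq_addC.
Qed.
Let pol_add0 : left_id (pol Ezero) pol_add.
Proof. by elim/pol_ind=> a; rewrite !polE; apply/polP/Eq_add0. Qed.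
Let pol_addN : left_inverse (pol Ezero) (pol_scale (-1)) pol_add.
Proof. by elim/pol_ind=> a; rewrite !polE; apply/polP/Eq_addN. Qed.

HB.instance Definition _ :=
  GRing.isZmodule.Build PolSn pol_addA pol_addC pol_add0 pol_addN.

Let pol_mulA : associative pol_mul.
Proof.
by elim/pol_ind=> a; elim/pol_ind=> b; elim/pol_ind=> c;
  rewrite !polE; apply/polP/Eq_mulA.
Qed.
Let pol_mul1l : left_id (pol Eone) pol_mul.
Proof. by elim/pol_ind=> a; rewrite !polE; apply/polP/Eq_mul1l. Qed.
Let pol_mul1r : right_id (pol Eone) pol_mul.
Proof. by elim/pol_ind=> a; rewrite !polE; apply/polP/Eq_mul1r. Qed.
Let pol_mulDl : left_distributive pol_mul pol_add.
Proof.
by elim/pol_ind=> a; elim/pol_ind=> b; elim/pol_ind=> c;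
  rewrite !polE; apply/polP/Eq_mulDl.
Qed.
Let pol_mulDr : right_distributive pol_mul pol_add.
Proof.
by elim/pol_ind=> a; elim/pol_ind=> b; elim/pol_ind=> c;
  rewrite !polE; apply/polP/Eq_mulDr.
Qed.
Let pol_1neq0 : pol Eone != pol Ezero.
Proof.
apply/eqP => /polP /(eval_eq (delta_magic C n)) /= /eqP.
by rewrite oner_eq0.
Qed.

HB.instance Definition _ := GRing.Zmodule_isNzRing.Build PolSn
  pol_mulA pol_mul1l pol_mul1r pol_mulDl pol_mulDr pol_1neq0.

Let pol_scaleA k l (x : PolSn) :
  pol_scale k (pol_scale l x) = pol_scale (k * l) x.
Proof. by elim/pol_ind: x => a; rewrite !polE; apply/polP/Eq_scaleA. Qed.
Let pol_scale1 : left_id 1 pol_scale.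
Proof. by elim/pol_ind=> a; rewrite !polE; apply/polP/Eq_scale1. Qed.
Let pol_scaleDr : right_distributive pol_scale +%R.
Proof.
move=> k; elim/pol_ind=> a; elim/pol_ind=> b.
by rewrite /GRing.add /= !polE; apply/polP/Eq_scaleDr.
Qed.
Let pol_scaleDl (x : PolSn) : {morph pol_scale^~ x : k l / k + l}.
Proof.
move=> k l; elim/pol_ind: x => a.
by rewrite [RHS]/GRing.add /= !polE; apply/polP/Eq_scaleDl.
Qed.

HB.instance Definition _ := GRing.Zmodule_isLmodule.Build C PolSn
  pol_scaleA pol_scale1 pol_scaleDr pol_scaleDl.

Let pol_scaleAl (k : C) (x y : PolSn) : k *: (x * y) = (k *: x) * y.
Proof.
elim/pol_ind: x => a; elim/pol_ind: y => b.
rewrite /GRing.scale /GRing.mul /= !polE; exact/polP/Eq_scaleAl.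
Qed.
HB.instance Definition _ :=
  GRing.Lmodule_isLalgebra.Build C PolSn pol_scaleAl.

Let pol_scaleAr (k : C) (x y : PolSn) : k *: (x * y) = x * (k *: y).
Proof.
elim/pol_ind: x => a; elim/pol_ind: y => b.
rewrite /GRing.scale /GRing.mul /= !polE; exact/polP/Eq_scaleAr.
Qed.
HB.instance Definition _ :=
  GRing.Lalgebra_isAlgebra.Build C PolSn pol_scaleAr.

Let pol_starD (x y : PolSn) : pol_star (x + y) = pol_star x + pol_star y.
Proof.
elim/pol_ind: x => a; elim/pol_ind: y => b.
rewrite /GRing.add /= !polE; exact/polP/Eq_starD.
Qed.
Let pol_starZ (k : C) (x : PolSn) : pol_star (k *: x) = k^* *: pol_star x.
Proof.
elim/pol_ind: x => a; rewrite /GRing.scale /= !polE; exact/polP/Eq_starZ.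
Qed.
Let pol_starM (x y : PolSn) : pol_star (x * y) = pol_star y * pol_star x.
Proof.
elim/pol_ind: x => a; elim/pol_ind: y => b.
rewrite /GRing.mul /= !polE; exact/polP/Eq_starM.
Qed.
Let pol_starK (x : PolSn) : pol_star (pol_star x) = x.
Proof. elim/pol_ind: x => a; rewrite !polE; exact/polP/Eq_starK. Qed.

HB.instance Definition _ := Algebra_isStarAlgebra.Build C PolSn
  pol_starD pol_starZ pol_starM pol_starK.

Lemma pol0 : pol Ezero = 0.
Proof. by []. Qed.
Lemma pol1 : pol Eone = 1.
Proof. by []. Qed.
Lemma polD a b : pol (Eadd a b) = pol a + pol b.
Proof. by rewrite -pol_addE. Qed.
Lemma polZ k a : pol (Escale k a) = k *: pol a.
Proof. by rewrite -pol_scaleE. Qed.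
Lemma polM a b : pol (Emul a b) = pol a * pol b.
Proof. by rewrite -pol_mulE. Qed.
Lemma polS a : pol (Estar a) = star (pol a).
Proof. by rewrite -pol_starE. Qed.

Lemma pol_sum (F : 'I_n -> expr C n) :
  pol (\big[@Eadd C n/Ezero]_(j < n) F j) = \sum_(j < n) pol (F j).
Proof. exact: (big_morph pol polD). Qed.

Lemma pol_gen_magic : magic_unitary pol_gen.
Proof.
split=> [i j|i j|i j k jk|i j k jk|i|i].
- by rewrite -polS; exact/polP/Eq_gen_star.
- by rewrite -polM; exact/polP/Eq_gen_idem.
- by rewrite -polM -pol0; exact/polP/Eq_gen_row.
- by rewrite -polM -pol0; exact/polP/Eq_gen_col.
- by rewrite -pol_sum -pol1; exact/polP/Eq_gen_row_sum.
- by rewrite -pol_sum -pol1; exact/polP/Eq_gen_col_sum.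
Qed.

Definition pol_lift (A : starAlgType C) (u : 'I_n -> 'I_n -> A)
  (x : PolSn) : A := eval u (pol_repr x).

End Quotient.

Arguments pol_gen {C n}.

Record star_morphism (C : numClosedFieldType) (A B : starAlgType C)
    (f : A -> B) : Prop := StarMorphism {
  star_morphism_linear : linear f;
  star_morphism_one : f 1 = 1;
  star_morphism_mul : forall a b, f (a * b) = f a * f b;
  star_morphism_star : forall a, f (star a) = star (f a)
}.

Lemma pol_liftE (C : numClosedFieldType) (n : nat) (A : starAlgType C)
    (u : 'I_n -> 'I_n -> A) :
  magic_unitary u -> forall a, pol_lift u (pol a) = eval u a.
Proof. by move=> uP a; apply: (eval_eq uP); exact: pol_reprP. Qed.

Lemma PolSn_universal (C : numClosedFieldType) (n : nat) (A : starAlgType C)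
    (u : 'I_n -> 'I_n -> A) : magic_unitary u ->
  (star_morphism (pol_lift u) /\
     forall i j, pol_lift u (pol_gen i j) = u i j) /\
  (forall f : PolSn C n -> A, star_morphism f ->
     (forall i j, f (pol_gen i j) = u i j) -> f = pol_lift u).
Proof.
move=> uP; have E := pol_liftE uP; split; first (split; first split).
- move=> k; elim/pol_ind=> a; elim/pol_ind=> b.
  by rewrite -polZ -polD !E.
- by rewrite -pol1 E.
- by elim/pol_ind=> a; elim/pol_ind=> b; rewrite -polM !E.
- by elim/pol_ind=> a; rewrite -polS !E.
- by move=> i j; rewrite E.
move=> f [fL f1 fM fS] fg; apply/funext; elim/pol_ind=> e; rewrite E.
have f0 : f 0 = 0.
  by have := fL (-1) 0 0; rewrite scaler0 addr0 scaleN1r addNr.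
have fD a b : f (a + b) = f a + f b by rewrite -[a]scale1r fL !scale1r.
have fZ k a : f (k *: a) = k *: f a by rewrite -[k *: a]addr0 fL f0 addr0.
elim: e => [i j||| a IHa b IHb|k a IHa|a IHa b IHb|a IHa] /=.
- exact: fg.
- exact: f0.
- exact: f1.
- by rewrite polD fD IHa IHb.
- by rewrite polZ fZ IHa.
- by rewrite polM fM IHa IHb.
- by rewrite polS fS IHa.
Qed.

Definition counit (C : numClosedFieldType) (n : nat) (a : PolSn C n) : C :=
  pol_lift (fun i j : 'I_n => (i == j)%:R : C^o) a.

Lemma counit_morphism (C : numClosedFieldType) (n : nat) :
  star_morphism (@counit C n : PolSn C n -> C^o).
Proof. exact: (PolSn_universal (delta_magic C n)).1.1. Qed.

Lemma counit_gen (C : numClosedFieldType) (n : nat) (i j : 'I_n) :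
  counit (pol_gen i j : PolSn C n) = (i == j)%:R.
Proof. exact: (PolSn_universal (delta_magic C n)).1.2. Qed.

(** The norm of a normed space over [R[i]] takes its values in [R[i]].
    The inner product is linear in its second argument. *)
HB.mixin Record CompleteNormedModule_isHilbert (R : realType) H
    of CompleteNormedModule R[i] H := {
  inner : H -> H -> R[i];
  inner_linear : forall x : H, scalar (inner x);
  inner_conj : forall x y : H, inner y x = (inner x y)^*;
  inner_norm : forall x : H, inner x x = `|x| ^+ 2
}.

#[short(type="hilbertType")]
HB.structure Definition Hilbert (R : realType) :=
  {H of CompleteNormedModule R[i] H & CompleteNormedModule_isHilbert R H}.

Record bounded_operator (R : realType) (h : hilbertType R) (T : h -> h) :
    Prop := BoundedOperator {
  bounded_operator_linear : linear T;
  bounded_operator_bound : exists M : R[i], forall x, `|T x| <= M * `|x|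
}.

(** A unital star-homomorphism from [A] to the bounded operators on [h];
    [repr_star] says that [rho (star a)] is the adjoint of [rho a]. *)
Record representation (R : realType) (A : starAlgType R[i])
    (h : hilbertType R) (rho : A -> h -> h) : Prop := Representation {
  repr_bounded : forall a, bounded_operator (rho a);
  repr_linear : forall (c : R[i]) (a b : A) (x : h),
    rho (c *: a + b) x = c *: rho a x + rho b x;
  repr_one : forall x, rho 1 x = x;
  repr_mul : forall a b x, rho (a * b) x = rho a (rho b x);
  repr_star : forall a x y, inner (rho (star a) x) y = inner x (rho a y)
}.

Record schurmann_triple (R : realType) (n : nat) (h : hilbertType R)
    (rho : PolSn R[i] n -> h -> h) (eta : PolSn R[i] n -> h)
    (L : PolSn R[i] n -> R[i]) : Prop := SchurmannTriple {
  schurmann_repr : representation rho;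
  schurmann_cocycle_linear : linear eta;
  schurmann_cocycle : forall a b,
    eta (a * b) = rho a (eta b) + counit b *: eta a;
  schurmann_functional_linear : scalar L;
  schurmann_hermitian : forall a, L (star a) = (L a)^*;
  schurmann_coboundary : forall a b,
    L (star a * b) = inner (eta a) (eta b)
      + counit (star a) * L b + L (star a) * counit b
}.

(* Main.v *)
Require Import Defs.
From HB Require Import structures.
From mathcomp Require Import all_boot all_order all_algebra.
From mathcomp Require Import complex.
From mathcomp Require Import all_classical all_reals topology normedtype.
From mathcomp Require Import ring.
Import GRing.Theory Num.Theory.
Local Open Scope ring_scope.

(** The coboundary identity expresses [L (a * b)] through [eta], the counit,
    and the values [L a] and [L b], so [L] is determined by [eta] as soon as it
    is known on elements that generate the star-algebra.  On a self-adjoint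
    idempotent [p] the identity for [star p * p = p] closes up on itself: it
    reads [L p = `|eta p| ^+ 2 + 2 * counit p * L p], and [counit p] is [0] or
    [1], so [L p] is the squared norm of [eta p] up to the sign [1 - 2 * counit p]
    ([triple_projection]).  The generators and the unit are such idempotents,
    which gives the formula and starts the induction on star-algebra
    expressions behind [triple_unique]. *)

Lemma star1 (C : numClosedFieldType) (A : starAlgType C) : star (1 : A) = 1.
Proof. by rewrite -[LHS]mul1r -{1}[1]starK -starM mul1r starK. Qed.

Section Triple.
Variables (R : realType) (n : nat) (h : hilbertType R).
Variables (rho : PolSn R[i] n -> h -> h) (eta : PolSn R[i] n -> h).
Implicit Types (L : PolSn R[i] n -> R[i]) (a b p : PolSn R[i] n).

Lemma triple_mul L a b : schurmann_triple rho eta L ->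
  L (a * b) = inner (eta (star a)) (eta b) + counit a * L b + L a * counit b.
Proof. by move=> hL; rewrite -{1}[a]starK (schurmann_coboundary hL) starK. Qed.

Lemma triple_projection L p : schurmann_triple rho eta L ->
  star p = p -> p * p = p -> L p = (1 - 2 * counit p) * `|eta p| ^+ 2.
Proof.
move=> hL pS pI; have := triple_mul _ p p hL.
rewrite pS pI inner_norm [L p * _]mulrC -addrA -mulr2n => Lp.
have ep : counit p * counit p = counit p.
  by rewrite -[in RHS]pI (star_morphism_mul (counit_morphism _ _)).
have normE : `|eta p| ^+ 2 = (1 - 2 * counit p) * L p.
  by rewrite mulrBl mul1r {1}Lp -mulrA mulr_natl addrK.
(* the sign [1 - 2 * counit p] squares to [1], so it can be moved across *)
rewrite normE mulrA -[LHS]mul1r; congr (_ * _).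
have -> : (1 - 2 * counit p) * (1 - 2 * counit p)
    = 1 + 4 * (counit p * counit p - counit p) by ring.
by rewrite ep subrr mulr0 addr0.
Qed.

Lemma triple_unique L L' :
  schurmann_triple rho eta L -> schurmann_triple rho eta L' -> L' = L.
Proof.
move=> hL hL'; apply/funext; elim/pol_ind.
have linL K : schurmann_triple rho eta K ->
    [/\ K 0 = 0, forall a b, K (a + b) = K a + K b
      & forall c a, K (c *: a) = c * K a].
  move=> /schurmann_functional_linear KL.
  have K0 : K 0 = 0 by have := KL (-1) 0 0; rewrite scaler0 addr0 mulN1r addNr.
  split=> // [a b|c a]; first by rewrite -[a]scale1r KL scale1r mul1r.
  by rewrite -[c *: a]addr0 KL K0 addr0.
have [L0 LD LZ] := linL _ hL; have [L'0 L'D L'Z] := linL _ hL'.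
have [uS uI _ _ _ _] := pol_gen_magic R[i] n.
elim=> [i j||| a IHa b IHb|c a IHa|a IHa b IHb|a IHa].
- by rewrite (triple_projection _ _ hL (uS i j) (uI i j))
             (triple_projection _ _ hL' (uS i j) (uI i j)).
- by rewrite pol0 L0 L'0.
- by rewrite pol1 (triple_projection _ _ hL (star1 _ _) (mulr1 1))
             (triple_projection _ _ hL' (star1 _ _) (mulr1 1)).
- by rewrite polD LD L'D IHa IHb.
- by rewrite polZ LZ L'Z IHa.
- by rewrite polM (triple_mul _ _ _ hL) (triple_mul _ _ _ hL') IHa IHb.
- by rewrite polS (schurmann_hermitian hL) (schurmann_hermitian hL') IHa.
Qed.

End Triple.

Theorem lemma8p2 (R : realType) (n : nat) (hn : (1 <= n)%N)
    (h : hilbertType R) (rho : PolSn R[i] n -> h -> h)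
    (eta : PolSn R[i] n -> h) (L : PolSn R[i] n -> R[i])
    (hL : schurmann_triple rho eta L) :
  (forall L' : PolSn R[i] n -> R[i], schurmann_triple rho eta L' -> L' = L)
  /\ (forall i j : 'I_n,
        L (pol_gen i j) = (-1) ^+ (i == j) * `|eta (pol_gen i j)| ^+ 2).
Proof.
split=> [L' hL'|i j]; first exact: triple_unique hL hL'.
have [uS uI _ _ _ _] := pol_gen_magic R[i] n.
rewrite (triple_projection _ _ _ _ _ _ _ hL (uS i j) (uI i j)) counit_gen.
congr (_ * _); case: (i == j); last by rewrite mulr0 subr0.
by rewrite mulr1 opprD addNKr.
Qed.
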